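(* Let $n,r$ be positive integers. Then $$\left|P_{r,n}-\left(1-e^{-\frac{1}{n}}\right)\right|<\frac{1+2^r}{r!}.$$
   Context: For positive integers $n,r$, the wreath product $\mathbb{Z}/n\mathbb{Z}\wr S_r$ is $(\mathbb{Z}/n\mathbb{Z})^r\rtimes S_r$, where the symmetric group $S_r$ acts on $(\mathbb{Z}/n\mathbb{Z})^r$ by permuting coordinates; its order is $r!\,n^r$. It acts on the set $B(n,r)=\mathbb{Z}/n\mathbb{Z}\times\{1,\ldots,r\}$ as follows: $\sigma=((\overline{a_1},\ldots,\overline{a_r}),\pi)$ sends $(\overline{b},i)$ to $(\overline{b+a_i},\pi(i))$. Let $\operatorname{Fix}\sigma=\{(\overline{b},i)\in B(n,r)\mid\sigma(\overline{b},i)=(\overline{b},i)\}$, and define $$P_{r,n}=\frac{\left|\{\sigma\in\mathbb{Z}/n\mathbb{Z}\wr S_r\mid\operatorname{Fix}\sigma\neq\emptyset\}\right|}{\left|\mathbb{Z}/n\mathbb{Z}\wr S_r\right|}.$$ *)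

(* Defs.v *)
From HB Require Import structures.
From mathcomp Require Import all_boot all_order all_algebra all_fingroup.
From mathcomp Require Import reals sequences exp.

Set Implicit Arguments.
Unset Strict Implicit.
Unset Printing Implicit Defensive.

Import GRing.Theory.
Local Open Scope ring_scope.

(* Z/nZ for n > 0: then n.-1.+1 = n, and 'I_n.-1.+1 carries addition mod n.
   The library's 'Z_n is not used because 'Z_1 is Z/2Z. *)
Definition Zmod (n : nat) := 'I_n.-1.+1.

HB.instance Definition _ n := GRing.Zmodule.on (Zmod n).
HB.instance Definition _ n := Finite.on (Zmod n).

Lemma card_Zmod n : (0 < n)%N -> #|{: Zmod n}| = n.
Proof. by move=> n_gt0; rewrite card_ord prednK. Qed.

(* The pair (a, pi) is ((a_1, ..., a_r), pi), coordinates being numbered from 0.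
   It is an alias, so as not to inherit the direct product group law of pairs. *)
Definition wreath (n r : nat) := ({ffun 'I_r -> Zmod n} * 'S_r)%type.

HB.instance Definition _ n r := Finite.on (wreath n r).

Section WreathGroup.
Variables n r : nat.
Implicit Types s t u : wreath n r.

(* Products follow the library's convention, also used for 'S_r, that s * t is
   s followed by t. *)
Definition wreath_mul s t : wreath n r :=
  ([ffun i => s.1 i + t.1 (s.2 i)], (s.2 * t.2)%g).

Definition wreath_one : wreath n r := ([ffun=> 0], 1%g).

Definition wreath_inv s : wreath n r :=
  ([ffun i => - s.1 ((s.2^-1)%g i)], (s.2^-1)%g).

Lemma wreath_mulA : associative wreath_mul.
Proof.
move=> s t u; congr pair; last exact: mulgA.
by apply/ffunP => i; rewrite !ffunE /= permM addrA.
Qed.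

Lemma wreath_mul1 : left_id wreath_one wreath_mul.
Proof.
move=> [a p]; congr pair; last exact: mul1g.
by apply/ffunP => i; rewrite !ffunE /= perm1 add0r.
Qed.

Lemma wreath_mulV : left_inverse wreath_one wreath_inv wreath_mul.
Proof.
move=> [a p]; congr pair; last exact: mulVg.
by apply/ffunP => i; rewrite !ffunE /= addNr.
Qed.

HB.instance Definition _ :=
  Finite_isGroup.Build (wreath n r) wreath_mulA wreath_mul1 wreath_mulV.

Definition wreath_act (x : Zmod n * 'I_r) s : Zmod n * 'I_r :=
  (x.1 + s.1 x.2, s.2 x.2).

Lemma wreath_act1 x : wreath_act x 1%g = x.
Proof. by case: x => b i; rewrite /wreath_act /= ffunE perm1 addr0. Qed.

Lemma wreath_actM x s t :
  wreath_act x (s * t)%g = wreath_act (wreath_act x s) t.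
Proof. by case: x => b i; rewrite /wreath_act /= ffunE permM addrA. Qed.

Canonical wreath_action := TotalAction wreath_act1 wreath_actM.

Lemma card_wreath : (0 < n)%N -> #|[set: wreath n r]| = (r`! * n ^ r)%N.
Proof.
move=> n_gt0; rewrite cardsT card_prod card_ffun card_Zmod // card_ord.
by rewrite card_Sn mulnC.
Qed.

End WreathGroup.

Arguments wreath_action {n r}.

Definition fix_proportion (R : realType) (n r : nat) : R :=
  #|[set s : wreath n r | ('Fix_wreath_action[s])%g != set0]|%:R
    / #|[set: wreath n r]|%:R.

(* Main.v *)
Require Import Defs.
From mathcomp Require Import classical_sets topology normedtype.
From mathcomp Require Import all_boot all_order all_algebra all_fingroup.
From mathcomp Require Import reals sequences exp.
From mathcomp Require Import ring.

(** An element s = (a, p) fixes a point of B(n, r) iff some index i satisfies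
    a_i = 0 and p i = i: it then fixes all n points over i.  Prescribing this at
    the indices of a set A leaves (r - #|A|)! n ^ (r - #|A|) elements, so by
    inclusion-exclusion the proportion of elements without fixed points is

      \sum_(k <= r) (-1) ^ k 'C(r, k) (r - k)! n ^ (r - k) / (r! n ^ r)
        = \sum_(k <= r) (- 1 / n) ^ k / k!,

    which is the Taylor polynomial of degree r of exp at - 1 / n
    (fix_proportionE).  Hence the quantity to bound is the tail of an
    exponential series at a point of [-1, 1].  A comparison with a telescoping
    sum bounds it by 1 / r! (expR_taylor_le), less than (1 + 2 ^ r) / r!. *)

Import Order.TTheory GRing.Theory Num.Theory.
Import numFieldNormedType.Exports.

Local Open Scope ring_scope.

(** The indicator of avoiding every F i is the product of the 1 - F i t;
    expanding it over the subsets A of I and summing over t gives the formula. *)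
Lemma inclusion_exclusion {R : comNzRingType} {T I : finType}
    (F : I -> pred T) :
  #|[set t | [forall i, ~~ F i t]]|%:R
    = \sum_(A : {set I}) (-1) ^+ #|A| * #|[set t | [forall i in A, F i t]]|%:R
    :> R.
Proof.
have cardE (P : pred T) : #|[set t | P t]|%:R = \sum_t (P t)%:R :> R.
  rewrite -sum1_card natr_sum big_mkcond; apply: eq_bigr => t _.
  by rewrite inE; case: (P t).
rewrite cardE.
transitivity (\sum_t \prod_i (- (F i t)%:R + 1) : R).
  apply: eq_bigr => t _; case: forallP => [noF | /forallP].
    by rewrite big1 // => i _; rewrite (negbTE (noF i)) oppr0 add0r.
  rewrite negb_forall => /existsP[i /negPn Fit].
  by rewrite (bigD1 i) //= Fit addNr mul0r.
under eq_bigr do rewrite bigA_distr.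
rewrite exchange_big; apply: eq_bigr => A _.
rewrite cardE mulr_sumr; apply: eq_bigr => t _.
rewrite -big_mkcond prodrN; congr (_ * _).
case: forall_inP => [allF | /forall_inP].
  by rewrite big1 // => i /allF ->.
rewrite negb_forall_in => /exists_inP[i iA /negbTE Fit].
by rewrite (bigD1 i) //= Fit mul0r.
Qed.

Lemma sum_over_card {R : nzRingType} {I : finType} (f : nat -> R) :
  \sum_(A : {set I}) f #|A| = \sum_(k < #|I|.+1) f k *+ 'C(#|I|, k).
Proof.
have cardI (A : {set I}) : (#|A| < #|I|.+1)%N by rewrite ltnS max_card.
rewrite (partition_big (fun A : {set I} => Ordinal (cardI A)) xpredT) //=.
apply: eq_bigr => k _; rewrite -card_draws -sumr_const.
by apply: eq_big => [A|A /eqP<-] //; rewrite inE.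
Qed.

Lemma card_perm_fixing {T : finType} (A : {set T}) :
  #|[set p : {perm T} | [forall i in A, p i == i]]| = (#|T| - #|A|)`!.
Proof.
rewrite -[in RHS](setCK A) -cardsCs -card_perm; apply: eq_card => p.
rewrite !inE [RHS]unfold_in; apply/forall_inP/subsetP => [fixp i | onp i iA].
  by rewrite !inE; apply: contra => /fixp.
by apply/negPn/negP => /onp; rewrite inE iA.
Qed.

Lemma card_ffun_vanishing {T Z : finType} (z : Z) (A : {set T}) :
  #|[set f : {ffun T -> Z} | [forall i in A, f i == z]]|
    = (#|Z| ^ (#|T| - #|A|))%N.
Proof.
rewrite -[in RHS](setCK A) -cardsCs -(card_pffun_on z); apply: eq_card => f.
rewrite !inE; apply/forall_inP/pffun_onP => [fA | [fA _] i iA].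
  split=> //; apply/subsetP=> i; rewrite !inE; exact/contra/fA.
by apply/negPn/negP => /(subsetP fA); rewrite inE iA.
Qed.

Section Wreath.
Variables n r : nat.
Hypothesis n_gt0 : (0 < n)%N.

Definition fixes_fiber (i : 'I_r) (s : wreath n r) :=
  (s.1 i == 0) && (s.2 i == i).

(** Whether s fixes (b, i) does not depend on b, so fixed points come in whole
    fibers, none of which is empty. *)
Lemma wreath_fix_eq0 (s : wreath n r) :
  (('Fix_wreath_action[s])%g == set0) = [forall i, ~~ fixes_fiber i s].
Proof.
apply/eqP/forallP => [fix0 i | noF].
  apply/negP => /andP[/eqP si0 /eqP sii].
  suff: (0, i) \in ('Fix_wreath_action[s])%g by rewrite fix0 inE.
  by apply/afix1P; rewrite /= /wreath_act /= si0 sii addr0.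
apply/setP => -[b i]; rewrite in_set0; apply/afix1P => -[sb si].
case/negP: (noF i).
by rewrite /fixes_fiber si -(inj_eq (addrI b)) sb addr0 !eqxx.
Qed.

Lemma card_fixes_fibers (A : {set 'I_r}) :
  #|[set s : wreath n r | [forall i in A, fixes_fiber i s]]|
    = ((r - #|A|)`! * n ^ (r - #|A|))%N.
Proof.
have := card_perm_fixing A; have := card_ffun_vanishing (0 : Zmod n) A.
rewrite card_Zmod // card_ord => <- <-; rewrite mulnC -cardsX.
apply: eq_card => -[a p]; rewrite !inE /=.
apply/forall_inP/andP => [fixA | [/forall_inP a0 /forall_inP pA] i iA].
  by split; apply/forall_inP => i /fixA /andP[].
by rewrite /fixes_fiber /= a0 ?pA.
Qed.

(** Inclusion-exclusion over the fixed fibers: the k-th term of the exponential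
    series comes from the sets of k fibers, since
    'C(r, k) (r - k)! n ^ (r - k) = r! n ^ r / (k! n ^ k). *)
Lemma fix_proportionE (R : realType) :
  fix_proportion R n r = 1 - series (exp_coeff (- n%:R^-1)) r.+1.
Proof.
pose W := (r`! * n ^ r)%N.
have W_neq0 : W%:R != 0 :> R.
  by rewrite pnatr_eq0 -lt0n muln_gt0 fact_gt0 expn_gt0 n_gt0.
rewrite /fix_proportion card_wreath // -/W.
apply: (mulIf W_neq0); rewrite divfK // mulrBl mul1r.
apply/eqP; rewrite eq_sym subr_eq eq_sym; apply/eqP.
have -> : series (exp_coeff (- n%:R^-1 : R)) r.+1 * W%:R
    = #|[set s : wreath n r | [forall i, ~~ fixes_fiber i s]]|%:R.
  rewrite inclusion_exclusion.
  under [RHS]eq_bigr do rewrite card_fixes_fibers.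
  rewrite (sum_over_card (fun k => (-1) ^+ k * ((r - k)`! * n ^ (r - k))%:R)).
  rewrite card_ord /series /= big_mkord mulr_suml; apply: eq_bigr => k _.
  have k_le : (k <= r)%N by rewrite -ltnS.
  have nk : n%:R ^+ k != 0 :> R by rewrite expf_neq0 // pnatr_eq0 -lt0n.
  have fk : k`!%:R != 0 :> R by rewrite pnatr_eq0 -lt0n fact_gt0.
  have nr : (n ^ r = n ^ k * n ^ (r - k))%N by rewrite -expnD subnKC.
  rewrite /W -(bin_fact k_le) nr -[RHS]mulr_natr.
  rewrite /exp_coeff /= (exprNn n%:R^-1) exprVn !natrM (natrX _ n k).
  by field; rewrite fk nk.
rewrite -natrD /W -(card_wreath r n_gt0) cardsT; congr _%:R.
rewrite -[RHS](cardsC [set s | ('Fix_wreath_action[s])%g != set0]).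
congr (_ + _)%N.
by apply: eq_card => s; rewrite !inE negbK wreath_fix_eq0.
Qed.

End Wreath.

(** For k > 0, 2 / (k + 1)! <= 1 / k!, so the term of index k + 1 is at most
    1 / (k + 1)! <= 1 / k! - 1 / (k + 1)!; the sum of these bounds over k >= m
    telescopes to at most 1 / m!. *)
Lemma expR_taylor_le {R : realType} {x : R} {m : nat} :
  `|x| <= 1 -> (0 < m)%N ->
  `|expR x - series (exp_coeff x) m.+1| <= m`!%:R^-1.
Proof.
move=> x_le1 m_gt0.
have term_le k : (0 < k)%N ->
    `|exp_coeff x k.+1| <= k`!%:R^-1 - k.+1`!%:R^-1.
  move=> k_gt0.
  have f0 : 0 < k`!%:R :> R by rewrite ltr0n fact_gt0.
  rewrite /exp_coeff /= normrM normfV normr_nat normrX.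
  rewrite lerBrDr (@le_trans _ _ (2 / k.+1`!%:R)) //.
    by rewrite mulr_natl mulr2n lerD2r ler_piMl ?invr_ge0 ?exprn_ile1.
  rewrite factS natrM invfM mulrA ler_piMl ?invr_ge0 ?ler0n //.
  by rewrite ler_pdivrMr ?ltr0n // mul1r ler_nat.
have partial_le N : (m < N)%N ->
    `|series (exp_coeff x) N - series (exp_coeff x) m.+1| <= m`!%:R^-1.
  case: N => // N mN; rewrite sub_series_geq //.
  apply: le_trans (ler_norm_sum _ _ _) _.
  rewrite big_add1 /=.
  have le1 : \sum_(m <= k < N) `|exp_coeff x k.+1|
      <= \sum_(m <= k < N) (k`!%:R^-1 - k.+1`!%:R^-1).
    by apply: ler_sum_nat => k /andP[mk _]; apply/term_le/(leq_trans m_gt0).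
  apply: le_trans le1 _.
  rewrite -[leLHS]opprK -sumrN; under eq_bigr do rewrite opprB.
  by rewrite telescope_sumr // opprB gerBl invr_ge0.
have cvS : (series (exp_coeff x) @ \oo --> expR x)%classic
  := is_cvg_series_exp_coeff x.
have cvD : ((fun N => `|series (exp_coeff x) N - series (exp_coeff x) m.+1|)
    @ \oo --> `|expR x - series (exp_coeff x) m.+1|)%classic.
  by apply: cvg_norm; apply: cvgB => //; apply: cvg_cst.
by apply: (cvgr_to_le cvD); exists m.+1 => // N /= mN; apply: partial_le.
Qed.

Theorem theorem3p5 (R : realType) (n r : nat) (n_gt0 : (0 < n)%N)
    (r_gt0 : (0 < r)%N) :
  `|fix_proportion R n r - (1 - expR (- (n%:R^-1)))|
    < (1 + 2 ^+ r) / (r`!)%:R.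
Proof.
have n1_le1 : `|- n%:R^-1 : R| <= 1.
  by rewrite normrN normfV normr_nat invf_le1 ?ltr0n // ler1n.
rewrite fix_proportionE // opprB addrC addrA subrK.
apply: le_lt_trans (expR_taylor_le n1_le1 r_gt0) _.
have f0 : 0 < r`!%:R^-1 :> R by rewrite invr_gt0 ltr0n fact_gt0.
by rewrite -[ltLHS]mul1r ltr_pM2r // ltrDl exprn_gt0.
Qed.
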